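(* Let $F$ and $G$ be absolutely continuous functions on a closed interval $I$ of finite length, let $f=F'$ and $g=G'$, and let $\hat F$ and $\hat G$ denote the least concave majorants of $F$ and $G$. Then $\hat F$ and $\hat G$ are also absolutely continuous on $I$ and, with $f^\circ=(\hat F)'$ and $g^\circ=(\hat G)'$, $$\|f^\circ-g^\circ\|_\infty=\|(\hat F)'-(\hat G)'\|_\infty\le\|f-g\|_\infty .$$
   Context: For a continuous function $F$ on $I$ the least concave majorant is $\hat F(x)=\inf\{G(x): G\ge F\text{ on }I,\ G\text{ concave}\}$, $x\in I$. Derivatives of absolutely continuous functions are defined almost everywhere, and $\|\cdot\|_\infty$ denotes the (essential) supremum norm on $I$ (possibly $+\infty$). The function $f^\circ=(\hat F)'$ is called the level function of $f=F'$. *)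

(* Defs.v *)
From HB Require Import structures.
From mathcomp Require Import all_boot all_order all_algebra.
From mathcomp Require Import all_classical all_reals all_analysis.

Set Implicit Arguments.
Unset Strict Implicit.
Unset Printing Implicit Defensive.

Import Order.TTheory GRing.Theory Num.Theory.
Import numFieldNormedType.Exports.

Local Open Scope classical_set_scope.
Local Open Scope ring_scope.

(* A function on the interval [a, b] is represented by a total function R -> R
   whose values outside of [a, b] are irrelevant: the definitions below only
   depend on the values on [a, b], and the two-sided derivative F^`() only on
   the values on ]a, b[ at the points of ]a, b[, that is, almost everywhere on
   [a, b]. *)

Definition absolutely_continuous_on (R : realType) (a b : R) (F : R -> R) :
    Prop :=
  forall e : R, 0 < e -> exists2 d : R, 0 < d &
    forall (n : nat) (u v : 'I_n -> R),
      (forall i, [/\ a <= u i, u i <= v i & v i <= b]) ->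
      trivIset [set: 'I_n] (fun i => [set` `]u i, v i[ ]) ->
      \sum_(i < n) (v i - u i) < d ->
      \sum_(i < n) `|F (v i) - F (u i)| < e.

Definition concave_on (R : realType) (a b : R) (G : R -> R) : Prop :=
  convex_function ([set` `[a, b] ] : set (convex_lmodType R^o)) (\- G).

(* For continuous F and x in [a, b], the set is nonempty and bounded below by
   F x, so that inf is its genuine greatest lower bound. *)
Definition least_concave_majorant (R : realType) (a b : R) (F : R -> R)
    (x : R) : R :=
  inf [set G x | G in [set G : R -> R |
    {in `[a, b], forall y, F y <= G y} /\ concave_on a b G]].

(* The level function of the derivative of F. It is a function of F, not of
   F^`(), whose values are arbitrary where F is not differentiable. *)
Definition level_function (R : realType) (a b : R) (F : R -> R) : R -> R :=
  (least_concave_majorant a b F)^`()%classic.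

(* The norm of L^oo([a, b]) for the Lebesgue measure (0 when a = b). *)
Definition Linfty_norm (R : realType) (a b : R) (h : R -> R) : \bar R :=
  Lnorm (mrestr lebesgue_measure (measurable_itv `[a, b])) +oo%E (EFin \o h).

(* Main.v *)
Require Import Defs.
From HB Require Import structures.
From mathcomp Require Import all_boot all_order all_algebra finmap.
From mathcomp Require Import all_classical all_reals all_analysis.
From mathcomp Require Import measurable_realfun ess_sup_inf ring lra.
Set Implicit Arguments.
Unset Strict Implicit.
Unset Printing Implicit Defensive.
Import Order.TTheory GRing.Theory Num.Theory.
Import numFieldNormedType.Exports.
Local Open Scope classical_set_scope.
Local Open Scope ring_scope.

(** Write M for the norm of f - g, assumed finite. The proof passes from
    derivatives to increments and back:

    - F - G is absolutely continuous with derivative bounded by M almost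
      everywhere, hence F - G is M-Lipschitz
      ([increment_dist_le_of_Linfty_norm]);
    - the difference of the least concave majorants is then M-Lipschitz as well
      ([least_concave_majorant_compare]);
    - the majorants are absolutely continuous, so they are differentiable almost
      everywhere, and where both are, their derivatives differ by at most M
      ([derive1_dist_le]).

    The core is the second step, which concerns arbitrary functions bounded
    above. If F y - F x <= G y - G x + M (y - x) for all x <= y, then for x <= y
    and 0 <= s <= y - x one has

      Fhat y + Ghat x <= Fhat (y - s) + Ghat (x + s) + M s.

    With F y + G x on the left this says that part of the mass sitting at y for F
    and at x for G may be exchanged: at the two points themselves it is the
    hypothesis, interpolated linearly by concavity. The right-hand side,
    minimized over s, is concave in y and in x separately, so the inequality for
    F y + G x upgrades to Fhat y, then to Ghat x, by the mere definition of the
    least concave majorant. Taking s = y - x gives the comparison.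

    A concave function on [a, b] can fail to be absolutely continuous only at the
    endpoints; there the majorant is controlled by affine majorants of F
    ([least_concave_majorant_usc]), and a concave function whose limits at the
    endpoints do not exceed its values is absolutely continuous
    ([concave_absolutely_continuous]).

    The remaining analytic input is Lebesgue's theorem that an absolutely
    continuous F is differentiable almost everywhere, together with the Lipschitz
    bound of the first step. The former is proved in the manner of Austin. If
    difference quotients of F above alpha and below - alpha both occur at
    arbitrarily small scale at the points of a set E, then inside an interval
    where F does not decrease, the many steep descents must be compensated, so
    the total variation exceeds the net increment by at least a multiple of
    alpha times the measure of E. Summed over a partition that almost realizes
    the total variation, this makes E null. The measure is extracted from the
    steep intervals by the covering lemma of Vitali ([maximal_steep_cover]). The
    Lipschitz bound uses Cousin's lemma: the interval is cut into pieces on which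
    either the derivative controls the increment, or the piece lies in an open
    set of small measure, where absolute continuity takes over. *)

(** * Comparison of least concave majorants *)

Section concave.
Context {R : realType} (a b : R).
Implicit Types F G Phi : R -> R.

(** Concavity with plain reals in place of the convex-space operations. *)
Lemma concave_onP G : concave_on a b G <->
  (forall x y t, a <= x <= b -> a <= y <= b -> 0 <= t <= 1 ->
    t * G x + (1 - t) * G y <= G (t * x + (1 - t) * y)).
Proof.
split=> [cG x y t xab yab t01|cG t x y].
- have t01' : Itv.spec (@Itv.num_sem R) (Itv.Real `[0, 1]%Z) t.
    by rewrite /Itv.spec /Itv.num_sem /= num_real in_itv /= t01.
  have := cG (Itv.mk t01') x y.
  rewrite !inE /= !in_itv /= => /(_ xab yab).
  by rewrite !convRE /= /unstable.onem !mulrN -opprD lerN2.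
- rewrite !inE /= !in_itv /= => xab yab.
  have t01 : 0 <= t%:num <= 1 by rewrite ge0 le1.
  have := cG x y t%:num xab yab t01.
  by rewrite !convRE /= /unstable.onem !mulrN -opprD lerN2.
Qed.

Lemma conv_itv x y t : a <= x <= b -> a <= y <= b -> 0 <= t <= 1 ->
  a <= t * x + (1 - t) * y <= b.
Proof. by move=> ? ? ?; apply/andP; split; nra. Qed.

Lemma concave_on_cst (c : R) : concave_on a b (fun=> c).
Proof. by apply/concave_onP => x y t _ _ _; lra. Qed.

Lemma concave_on_affine (c k z : R) : concave_on a b (fun x => c + k * (x - z)).
Proof. by apply/concave_onP => x y t _ _ _; lra. Qed.

Section majorant.
Variables (F : R -> R) (B : R).
Hypothesis FB : forall x, a <= x <= b -> F x <= B.
Local Notation Fh := (least_concave_majorant a b F).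

Let majorants (x : R) := [set G x | G in [set G : R -> R |
    {in `[a, b], forall y, F y <= G y} /\ concave_on a b G]].

Let majorants_neq0 x : majorants x !=set0.
Proof.
exists B; exists (fun=> B) => //; split; last exact: concave_on_cst.
by move=> y; rewrite in_itv; exact: FB.
Qed.

Lemma least_concave_majorant_le G x :
  (forall y, a <= y <= b -> F y <= G y) -> concave_on a b G ->
  a <= x <= b -> Fh x <= G x.
Proof.
move=> FG cG xab; apply: ge_inf.
- by exists (F x) => _ [H [FH _] <-]; apply: FH; rewrite in_itv.
- by exists G => //; split=> // y; rewrite in_itv => /FG.
Qed.

Lemma le_least_concave_majorant x : a <= x <= b -> F x <= Fh x.
Proof.
move=> xab; apply: lb_le_inf; first exact: majorants_neq0.
move=> _ [H [FH _] <-].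
by apply: FH; rewrite in_itv.
Qed.

Lemma least_concave_majorant_concave : concave_on a b Fh.
Proof.
apply/concave_onP => x y t xab yab t01.
apply: lb_le_inf; first exact: majorants_neq0.
move=> _ [H [FH cH] <-].
have FH' z : a <= z <= b -> F z <= H z by move=> zab; apply: FH; rewrite in_itv.
have /concave_onP/(_ x y t xab yab t01) := cH.
have := least_concave_majorant_le FH' cH xab.
have := least_concave_majorant_le FH' cH yab.
by nra.
Qed.

(** Pointwise infima of families are the source of concave majorants below: the
    mixing hypothesis says that A is jointly concave on the graph of S, which is
    what makes y |-> inf_s A y s concave. *)
Lemma least_concave_majorant_le_family (S : R -> set R) (A : R -> R -> R) :
  (forall y, a <= y <= b -> S y !=set0) ->
  (forall y s, a <= y <= b -> S y s -> F y <= A y s) ->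
  (forall y z t s, a <= y <= b -> a <= z <= b -> 0 <= t <= 1 ->
    S (t * y + (1 - t) * z) s -> exists2 s1, S y s1 & exists2 s2, S z s2 &
      t * A y s1 + (1 - t) * A z s2 <= A (t * y + (1 - t) * z) s) ->
  forall y s, a <= y <= b -> S y s -> Fh y <= A y s.
Proof.
move=> S0 FA mixA y s yab Sys.
pose K z := inf [set A z s | s in S z].
have KA z u : a <= z <= b -> S z u -> K z <= A z u.
  move=> zab Szu; apply: ge_inf; last by exists u.
  by exists (F z) => _ [w Sw <-]; exact: FA.
have Kglb z m : a <= z <= b -> (forall u, S z u -> m <= A z u) -> m <= K z.
  move=> zab mA; apply: lb_le_inf => [|_ [w Sw <-]]; last exact: mA.
  by have [u Su] := S0 _ zab; exists (A z u); exists u.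
apply: le_trans (KA _ _ yab Sys); apply: least_concave_majorant_le => //.
  by move=> z zab; apply: Kglb => // u; exact: FA.
apply/concave_onP => u v t uab vab t01; apply: Kglb => [|w Sw].
  exact: conv_itv.
have [s1 S1 [s2 S2]] := mixA _ _ _ _ uab vab t01 Sw.
have := KA _ _ uab S1; have := KA _ _ vab S2.
by nra.
Qed.

End majorant.

(** Both parts are scaled by the same ratio s / (t p + (1 - t) q). *)
Lemma split_between (t p q s : R) : 0 <= t <= 1 -> 0 <= p -> 0 <= q ->
  0 <= s <= t * p + (1 - t) * q ->
  exists2 s1, 0 <= s1 <= p & exists2 s2, 0 <= s2 <= q &
    s = t * s1 + (1 - t) * s2.
Proof.
move=> t01 p0 q0 /andP[s0 sT].
have [T0|T0] := leP (t * p + (1 - t) * q) 0.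
  exists 0; first by rewrite lexx.
  by exists 0; [rewrite lexx|lra].
pose k := s / (t * p + (1 - t) * q).
have kT : k * (t * p + (1 - t) * q) = s by rewrite divfK// gt_eqF.
have k0 : 0 <= k by rewrite divr_ge0// ltW.
have k1 : k <= 1 by rewrite ler_pdivrMr// mul1r.
exists (k * p); first by nra.
by exists (k * q); [nra|rewrite -kT; ring].
Qed.

(** The positive part of y - r is a convex function of y, so a shift that is
    admissible at a convex combination splits into admissible shifts at its two
    points. *)
Lemma split_excess (t y z r s : R) : 0 <= t <= 1 ->
  0 <= s <= Num.max 0 (t * y + (1 - t) * z - r) ->
  exists2 s1, 0 <= s1 <= Num.max 0 (y - r) &
  exists2 s2, 0 <= s2 <= Num.max 0 (z - r) &
    s = t * s1 + (1 - t) * s2.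
Proof.
move=> t01 /andP[s0 sT]; apply: split_between => //; rewrite ?le_max ?lexx//.
rewrite s0 (le_trans sT)// ge_max.
have y0 : 0 <= Num.max 0 (y - r) by rewrite le_max lexx.
have z0 : 0 <= Num.max 0 (z - r) by rewrite le_max lexx.
have yr : y - r <= Num.max 0 (y - r) by rewrite le_max lexx orbT.
have zr : z - r <= Num.max 0 (z - r) by rewrite le_max lexx orbT.
by apply/andP; split; nra.
Qed.

Section comparison.
Variables (F G : R -> R) (B M : R).
Hypothesis FB : forall x, a <= x <= b -> F x <= B.
Hypothesis GB : forall x, a <= x <= b -> G x <= B.
Hypothesis FG : forall x y, a <= x -> x <= y -> y <= b ->
  F y - F x <= G y - G x + M * (y - x).
Local Notation Fh := (least_concave_majorant a b F).
Local Notation Gh := (least_concave_majorant a b G).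

Let swapped (y x s : R) := Fh (y - s) + Gh (x + s) + M * s.

Let swapped_conv (y x y' x' s s' t : R) : 0 <= t <= 1 ->
  a <= y <= b -> a <= x <= b -> a <= y' <= b -> a <= x' <= b ->
  0 <= s <= Num.max 0 (y - x) -> 0 <= s' <= Num.max 0 (y' - x') ->
  t * swapped y x s + (1 - t) * swapped y' x' s' <=
  swapped (t * y + (1 - t) * y') (t * x + (1 - t) * x') (t * s + (1 - t) * s').
Proof.
move=> t01 yab xab y'ab x'ab /andP[s0 sm] /andP[s'0 s'm].
have room u v w : a <= u <= b -> a <= v <= b -> 0 <= w ->
    w <= Num.max 0 (u - v) -> (a <= u - w <= b) /\ (a <= v + w <= b).
  by move=> ? ? ?; rewrite le_max => /orP[] ?; split; apply/andP; split; lra.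
have [yab1 xab1] := room _ _ _ yab xab s0 sm.
have [yab2 xab2] := room _ _ _ y'ab x'ab s'0 s'm.
have /concave_onP cF := least_concave_majorant_concave FB.
have /concave_onP cG := least_concave_majorant_concave GB.
have := cF _ _ _ yab1 yab2 t01; have := cG _ _ _ xab1 xab2 t01.
rewrite /swapped.
set p := t * (y - s) + _; have -> : t * y + (1 - t) * y' - (t * s + (1 - t) * s') = p.
  by rewrite /p; ring.
set q := t * (x + s) + _; have -> : t * x + (1 - t) * x' + (t * s + (1 - t) * s') = q.
  by rewrite /q; ring.
by move=> ? ?; nra.
Qed.

Let swapped_base y x s : a <= y <= b -> a <= x <= b ->
  0 <= s <= Num.max 0 (y - x) -> F y + G x <= swapped y x s.
Proof.
move=> yab xab /andP[s0 sm].
have Fy := le_least_concave_majorant FB yab.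
have Fx := le_least_concave_majorant FB xab.
have Gy := le_least_concave_majorant GB yab.
have Gx := le_least_concave_majorant GB xab.
rewrite /swapped; have [xy|yx] := ltP x y; last first.
  have -> : s = 0.
    by apply/eqP; rewrite eq_le s0 (le_trans sm)// ge_max lexx subr_le0.
  by rewrite subr0 addr0 mulr0 addr0 lerD.
have {}sm : s <= y - x by rewrite (le_trans sm)// ge_max lexx; lra.
have yx0 : 0 < y - x by lra.
pose k := s / (y - x).
have kE : k * (y - x) = s by rewrite divfK// gt_eqF.
have k01 : 0 <= k <= 1.
  by rewrite divr_ge0 ?(ltW yx0)//= ler_pdivrMr// mul1r.
have /concave_onP cF := least_concave_majorant_concave FB.
have /concave_onP cG := least_concave_majorant_concave GB.
have := cF _ _ _ xab yab k01; have := cG _ _ _ yab xab k01.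
have -> : k * y + (1 - k) * x = x + s by rewrite -kE; ring.
have -> : k * x + (1 - k) * y = y - s by rewrite -kE; ring.
have ax : a <= x by case/andP: xab.
have yb : y <= b by case/andP: yab.
have := FG ax (ltW xy) yb.
rewrite -kE; move: k01 => /andP[]; nra.
Qed.

(** This is the exchange argument described at the top. The minimization over the
    shift s makes the right-hand side concave in each of the two points, and the
    definition of the least concave majorant is applied once in y and once in
    x. *)
Lemma least_concave_majorant_compare x y : a <= x -> x <= y -> y <= b ->
  Fh y - Fh x <= Gh y - Gh x + M * (y - x).
Proof.
move=> ax xy yb.
have xab : a <= x <= b by rewrite ax (le_trans xy).
have yab : a <= y <= b by rewrite yb (le_trans ax).
have S0 u v : [set s : R | 0 <= s <= Num.max 0 (u - v)] !=set0.
  by exists 0 => /=; rewrite lexx le_max lexx.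
(* Here r is fixed and the inequality for F is extended to its majorant. *)
have step1 r z s : a <= r <= b -> a <= z <= b -> 0 <= s <= Num.max 0 (z - r) ->
    Fh z + G r <= swapped z r s.
  move=> rab zab sr; rewrite -lerBrDr.
  refine (@least_concave_majorant_le_family F
    (fun z => [set s | 0 <= s <= Num.max 0 (z - r)])
    (fun z s => swapped z r s - G r) _ _ _ z s zab sr) => // {z s zab sr}.
    by move=> z s zab sr; rewrite lerBrDr; exact: swapped_base.
  move=> u v t s uab vab t01 /(split_excess t01)[s1 s1r [s2 s2r sE]].
  exists s1 => //; exists s2 => //.
  have := swapped_conv t01 uab rab vab rab s1r s2r.
  by rewrite -sE (_ : t * r + (1 - t) * r = r); [lra|ring].
(* Now y is fixed and the inequality for G is extended to its majorant. *)
have : Gh x <= swapped y x (y - x) - Fh y; last first.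
  by rewrite /swapped subKr (addrC x) subrK; lra.
refine (@least_concave_majorant_le_family G
    (fun x => [set s | 0 <= s <= Num.max 0 (y - x)])
    (fun x s => swapped y x s - Fh y) _ _ _ x (y - x) xab _) => //.
- by move=> r s rab sr; rewrite lerBrDl; exact: step1.
- move=> u v t s uab vab t01 /= sr.
  have [|s1 s1r [s2 s2r sE]] := @split_excess t (- u) (- v) (- y) s t01.
    move: sr; set p := y - _; set q := _ - - y.
    by have -> : p = q by rewrite /p /q; ring.
  have sh w : - w - - y = y - w by ring.
  rewrite !sh in s1r s2r.
  exists s1 => //; exists s2 => //.
  have := swapped_conv t01 yab uab yab vab s1r s2r.
  by rewrite -sE (_ : t * y + (1 - t) * y = y); [lra|ring].
- by rewrite /= subr_ge0 xy /= le_max lexx orbT.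
Qed.

End comparison.

End concave.

(** * A maximal inequality for monotone functions *)

Section increments.
Context {R : realType}.

(** Removing one nondegenerate interval splits the others into those on its left
    and those on its right, which gives an induction without sorting. A degenerate
    interval may lie strictly inside the removed one; as it contributes nothing,
    the bounds by a and b are stated for nondegenerate intervals only, a form that
    the induction preserves. *)
Lemma sum_increments_le (I : eqType) (s : seq I) (u v : I -> R) (Psi : R -> R)
    (a b : R) : a <= b ->
  (forall x y, a <= x -> x <= y -> y <= b -> Psi x <= Psi y) ->
  {in s, forall i, u i <= v i} ->
  {in s, forall i, u i < v i -> a <= u i /\ v i <= b} ->
  uniq s -> trivIset [set` s] (fun i => [set` `]u i, v i[ ]) ->
  \sum_(i <- s) (Psi (v i) - Psi (u i)) <= Psi b - Psi a.
Proof.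
have [n] := ubnP (size s); elim: n => // n IHn in s a b *.
case: s => [|i s] /=; rewrite ?ltnS => sn ab mono uv uvab.
  by rewrite big_nil => _ _; rewrite subr_ge0 mono.
move=> /andP[i_s us] ts; rewrite big_cons.
have subs (r : seq I) : {subset r <= s} -> trivIset [set` r] (fun i => [set` `]u i, v i[ ]).
  by move=> rs j k rj rk; apply: ts; rewrite /= inE rs ?orbT.
have uvs j : j \in s -> u j <= v j by move=> js; apply: uv; rewrite inE js orbT.
have uvabs j : j \in s -> u j < v j -> a <= u j /\ v j <= b.
  by move=> js; apply: uvab; rewrite inE js orbT.
have := uv i (mem_head _ _); rewrite le_eqVlt => /predU1P[uvi|uvi].
  by rewrite uvi subrr add0r; apply: IHn => //; apply: subs.
have [aui vib] := uvab i (mem_head _ _) uvi.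
rewrite (bigID (fun j => v j <= u i)) /=.
rewrite -[X in _ + (X + _)]big_filter -[X in _ + (_ + X)]big_filter.
set l := seq.filter _ s; set r := seq.filter _ s.
have ls : {subset l <= s} by move=> j; rewrite mem_filter => /andP[].
have rs : {subset r <= s} by move=> j; rewrite mem_filter => /andP[].
have sz p : (size (seq.filter p s) < n)%N.
  by rewrite size_filter (leq_ltn_trans (count_size _ _)).
have suml : \sum_(j <- l) (Psi (v j) - Psi (u j)) <= Psi (u i) - Psi a.
  apply: IHn => //;
    [exact: sz| | | |exact: filter_uniq|exact: subs].
  - by move=> x y ax xy yu; apply: mono => //; lra.
  - by move=> j /ls; exact: uvs.
  - move=> j jl uvj; split; first by have [] := uvabs _ (ls _ jl) uvj.
    by move: jl; rewrite mem_filter => /andP[].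
have sumr : \sum_(j <- r) (Psi (v j) - Psi (u j)) <= Psi b - Psi (v i).
  apply: IHn => //;
    [exact: sz| | | |exact: filter_uniq|exact: subs].
  - by move=> x y ax xy yu; apply: mono => //; lra.
  - by move=> j /rs; exact: uvs.
  - move=> j jr uvj; split; last by have [] := uvabs _ (rs _ jr) uvj.
    rewrite leNgt; apply/negP => ujvi.
    move: (jr); rewrite mem_filter => /andP[]; rewrite -ltNge => uivj js.
    have ij : i = j.
      apply: ts; rewrite /= ?inE ?eqxx ?js ?orbT//.
      exists ((Num.max (u i) (u j) + Num.min (v i) (v j)) / 2).
      have m1 : Num.max (u i) (u j) < Num.min (v i) (v j).
        by rewrite gt_max !lt_min uvi uivj ujvi uvj.
      have : u i <= Num.max (u i) (u j) by rewrite le_max lexx.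
      have : u j <= Num.max (u i) (u j) by rewrite le_max lexx orbT.
      have : Num.min (v i) (v j) <= v i by rewrite ge_min lexx.
      have : Num.min (v i) (v j) <= v j by rewrite ge_min lexx orbT.
      by move=> ? ? ? ?; split; rewrite /= in_itv /=; apply/andP; split; lra.
    by move: i_s; rewrite ij js.
by lra.
Qed.

End increments.

Section maximal.
Context {R : realType}.
Local Notation mu := (@lebesgue_measure R).

Definition steep_set (Psi : R -> R) (u v alpha : R) : set (R * R) :=
  [set p | [/\ u <= p.1, p.1 < p.2, p.2 <= v &
    alpha * (p.2 - p.1) <= Psi p.2 - Psi p.1]].

Definition steep_cover (Psi : R -> R) (u v alpha : R) : set R :=
  \bigcup_(p in steep_set Psi u v alpha) [set` `]p.1, p.2[ ].

Lemma steep_cover_open Psi u v alpha : open (steep_cover Psi u v alpha).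
Proof. by apply: bigcup_open => p _; exact: interval_open. Qed.

Lemma steep_cover_measurable Psi u v alpha :
  measurable (steep_cover Psi u v alpha).
Proof. by apply: open_measurable; exact: steep_cover_open. Qed.

Lemma ball_midpoint (s t : R) : ball ((s + t) / 2) ((t - s) / 2) = `]s, t[%classic.
Proof.
rewrite ball_itv.
have -> : (s + t) / 2 - (t - s) / 2 = s by lra.
by have -> : (s + t) / 2 + (t - s) / 2 = t by lra.
Qed.

(** For a compact subset of the union, Vitali's covering lemma extracts disjoint
    steep intervals of total length at least a third of its measure; along them
    Psi climbs at slope alpha, and it has only Psi v - Psi u to climb. *)
Lemma maximal_steep_cover (Psi : R -> R) (u v alpha : R) : u <= v -> 0 < alpha ->
  (forall x y, u <= x -> x <= y -> y <= v -> Psi x <= Psi y) ->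
  (mu (steep_cover Psi u v alpha) <= (3 * (Psi v - Psi u) / alpha)%:E)%E.
Proof.
move=> uv alpha0 mono.
rewrite lebesgue_regularity_inner_sup; last exact: steep_cover_measurable.
apply: ge_ereal_sup => /= _ [K [cK Ksteep] <-].
(* Indices with p.1 >= p.2 get the dummy radius 1, as the covering lemma asks
   for nonempty balls throughout. *)
pose rad (p : R * R) := if p.1 < p.2 then (p.2 - p.1) / 2 else 1.
have rad0 p : 0 < rad p by rewrite /rad; case: ifPn => // ?; rewrite divr_gt0// subr_gt0.
pose B (p : R * R) := ball ((p.1 + p.2) / 2) (rad p).
have BE p : p.1 < p.2 -> B p = `]p.1, p.2[%classic.
  by move=> pp; rewrite /B /rad pp ball_midpoint.
have KB : K `<=` cover (steep_set Psi u v alpha) B.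
  by move=> x /Ksteep[p Sp xp]; exists p => //; rewrite BE//; case: Sp.
have [D Dsub Kcover] : finite_subset_cover (steep_set Psi u v alpha) B K.
  move: cK; rewrite compact_cover => /(_ _ _ _ _ KB); apply.
  by move=> /= p _; exact: ball_open.
have is_ballB p : is_ball (B p) by exact: is_ball_ball.
have Bset0 p : B p !=set0 by exists ((p.1 + p.2) / 2); exact: ballxx.
have [E [uE ED tE DE]] := @vitali_lemma_finite_cover _ _ B is_ballB Bset0 D.
have Esteep p : p \in E -> steep_set Psi u v alpha p.
  by move=> /ED /Dsub /set_mem.
have muK : (mu K <= (3 * \sum_(p <- E) (p.2 - p.1))%:E)%E.
  have KE : K `<=` \big[setU/set0]_(p <- E) (3 *` B p).
    by move=> x /Kcover/DE; rewrite /cover bigcup_seq.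
  have mE p : measurable (3 *` B p).
    by rewrite scale_ballE//; exact: measurable_ball.
  have mK : measurable K.
    by apply: closed_measurable; apply: compact_closed => //; exact: Rhausdorff.
  apply: (le_trans (@content_subadditive _ _ _ mu K
      (fun i => 3 *` B (nth (0, 0) E i)) (size E) _ _ _)) => //.
  - by move=> k _; exact: mE.
  - by move: KE; rewrite (big_nth (0, 0)) big_mkord.
  - rewrite -(big_mkord xpredT (fun i => mu (3 *` B (nth (0, 0) E i)))).
  rewrite -(big_nth (0, 0) xpredT (fun p => mu (3 *` B p))) mulr_sumr -sumEFin.
  rewrite big_seq [leRHS]big_seq; apply: lee_sum => p /Esteep[_ pp _ _].
  rewrite scale_ballE// lebesgue_measure_ball ?mulr_ge0 ?(ltW (rad0 _))//.
  by rewrite lee_fin /rad pp -mulr_natr; lra.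
apply: le_trans muK _; rewrite lee_fin ler_pdivlMr// -mulrA ler_pM2l//.
rewrite mulrC mulr_sumr.
apply: (@le_trans _ _ (\sum_(p <- E) (Psi p.2 - Psi p.1))).
  by rewrite big_seq [leRHS]big_seq; apply: ler_sum => p /Esteep[].
apply: sum_increments_le => //.
- by move=> p /Esteep[_ /ltW].
- by move=> p /Esteep[].
- move=> p q /= pE qE; rewrite -!BE; first exact: tE.
  + by case: (Esteep _ qE).
  + by case: (Esteep _ pE).
Qed.

End maximal.

(** * Absolute continuity and bounded variation *)

Section absolutely_continuous.
Context {R : realType} (a b : R).
Implicit Types F G : R -> R.

Lemma absolutely_continuous_onB F G :
  absolutely_continuous_on a b F -> absolutely_continuous_on a b G ->
  absolutely_continuous_on a b (fun x => F x - G x).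
Proof.
move=> acF acG e e0.
have [|dF dF0 FP] := acF (e / 2); first by rewrite divr_gt0.
have [|dG dG0 GP] := acG (e / 2); first by rewrite divr_gt0.
exists (Num.min dF dG); first by rewrite lt_min dF0.
move=> n u v uv tuv; rewrite lt_min => /andP[sF sG].
have := ltrD (FP n u v uv tuv sF) (GP n u v uv tuv sG).
rewrite -splitr -big_split/=; apply: le_lt_trans; apply: ler_sum => i _.
have -> : F (v i) - G (v i) - (F (u i) - G (u i)) =
  (F (v i) - F (u i)) - (G (v i) - G (u i)) by ring.
exact: ler_normB.
Qed.

Lemma absolutely_continuous_on_linear (k : R) :
  absolutely_continuous_on a b (fun x => k * x).
Proof.
move=> e e0; have k1 : 0 < `|k| + 1 by rewrite ltr_pwDr.
exists (e / (`|k| + 1)); first by rewrite divr_gt0.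
move=> n u v uv _; rewrite ltr_pdivlMr// mulrC => le_e.
apply: le_lt_trans le_e; rewrite mulr_sumr; apply: ler_sum => i _.
have [_ uvi _] := uv i.
rewrite -mulrBr normrM (ger0_norm (_ : 0 <= v i - u i)) ?subr_ge0//.
by rewrite ler_wpM2r ?subr_ge0// lerDl.
Qed.

Lemma absolutely_continuous_on_continuous F : absolutely_continuous_on a b F ->
  forall e, 0 < e -> exists2 d, 0 < d & forall x y,
    a <= x <= b -> a <= y <= b -> `|y - x| < d -> `|F y - F x| < e.
Proof.
move=> acF e e0; have [d d0 dP] := acF e e0; exists d => // x y.
have dP1 u v : a <= u -> u <= v -> v <= b -> v - u < d -> `|F v - F u| < e.
  move=> au uv vb uvd.
  have := dP 1%N (fun=> u) (fun=> v); rewrite !big_ord1; apply => //.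
  by move=> i j _ _ _; rewrite (ord1 i) (ord1 j).
move=> /andP[ax xb] /andP[ay yb]; have [xy|/ltW yx] := leP x y.
  by rewrite ger0_norm ?subr_ge0//; exact: dP1.
by rewrite distrC (distrC (F y)) ger0_norm ?subr_ge0//; exact: dP1.
Qed.

(** The variation over a short interval is a sum over disjoint intervals of small
    total length. *)
Lemma absolutely_continuous_on_variation F e : absolutely_continuous_on a b F ->
  0 < e -> exists2 d, 0 < d & forall u v s, a <= u -> v <= b -> v - u < d ->
    itv_partition u v s -> variation u v F s <= e.
Proof.
move=> acF e0; have [d d0 dP] := acF e e0; exists d => // u v s au vb uvd uvs.
rewrite /variation big_mkord ltW//.
pose f i := nth v (u :: s) i.
have fle (i j : nat) : (i <= size s)%N -> (j <= i)%N -> f j <= f i.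
  move=> si; rewrite leq_eqVlt => /predU1P[->//|ji]; apply: ltW.
  case: uvs => /= us _.
  by rewrite /f (@lt_sorted_ltn_nth _ _ v (u :: s))// inE /= ltnS// ltnW// (leq_trans ji).
apply: (dP _ (fun i : 'I_(size s) => f i) (fun i => f i.+1)).
- move=> i; split; last 1 first.
  + by rewrite (le_trans _ vb)//; apply: itv_partition_nth_le uvs; rewrite ltnS.
  + rewrite (le_trans au)//; apply: itv_partition_nth_ge uvs.
    by rewrite ltnS ltnW.
  + exact: fle.
- move=> i j _ _ [x []]; rewrite /= !in_itv/= => /andP[fi fi1] /andP[fj fj1].
  apply/val_inj/eqP; rewrite eqn_leq leqNgt [X in _ && X]leqNgt.
  apply/andP; split; apply/negP => ij.
  + by have := fle i j.+1 (ltnW (ltn_ord i)) ij; lra.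
  + by have := fle j i.+1 (ltnW (ltn_ord j)) ij; lra.
- rewrite -(big_mkord xpredT (fun i => f i.+1 - f i)) telescope_sumr//.
  by rewrite /f (itv_partition_nth_size _ uvs).
Qed.

End absolutely_continuous.

Section cousin.
Context {R : realType}.

(** Cousin's lemma: an additive property of intervals that holds around every
    point holds globally. The supremum of the t with P a t is attained and
    equals b. *)
Lemma cousin (P : R -> R -> Prop) (a b : R) : a <= b ->
  (forall u w v, a <= u -> u <= w -> w <= v -> v <= b ->
    P u w -> P w v -> P u v) ->
  (forall x, a <= x <= b -> exists2 d, 0 < d & forall u v,
    a <= u -> u <= x -> x <= v -> v <= b -> x - d < u -> v < x + d -> P u v) ->
  P a b.
Proof.
move=> ab Padd Ploc.
pose S := [set t | a <= t <= b /\ P a t].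
have Sa : S a.
  split; first by rewrite lexx.
  have [|d d0] := Ploc a; first by rewrite lexx.
  by apply => //; rewrite ?gtrBl ?ltrDl.
have ubS : ubound S b by move=> t [/andP[]].
have supS : has_sup S by split; [exists a|exists b].
have ac : a <= sup S by apply: ub_le_sup => //; exists b.
have cb : sup S <= b by apply: ge_sup => //; exists a.
have [|d d0 Pd] := Ploc (sup S); first by rewrite ac.
have [t [/andP[atb tb] Pt] ct] := sup_adherent d0 supS.
have tc : t <= sup S by apply: ub_le_sup; [exists b|split=> //; apply/andP].
pose v := Num.min b (sup S + d / 2).
have cv : sup S <= v by rewrite le_min cb; lra.
have vb : v <= b by rewrite ge_min lexx.
have vd : v < sup S + d by rewrite gt_min; apply/orP; right; lra.
have Ptv : P t v by apply: Pd.
have Sv : S v.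
  split; first by rewrite vb andbT; lra.
  by apply: (Padd _ t) => //; lra.
have vc : v <= sup S by apply: ub_le_sup => //; exists b.
suff <- : v = b by case: Sv.
by move: vc; rewrite /v /Num.min; case: ifPn => // _; lra.
Qed.

End cousin.

Section variation_function.
Context {R : realType} (a b : R).

(** Finiteness of the total variation is additive, and local by
    [absolutely_continuous_on_variation]. *)
Lemma absolutely_continuous_on_total_variation_fin (F : R -> R) : a <= b ->
  absolutely_continuous_on a b F -> total_variation a b F \is a fin_num.
Proof.
move=> ab acF.
apply: (@cousin _ (fun u v => total_variation u v F \is a fin_num)) => //.
  move=> u w v au uw wv vb; rewrite (total_variationD F uw wv) fin_numD.
  by move=> -> ->.
have [d d0 dP] := absolutely_continuous_on_variation acF ltr01.
move=> x _; exists (d / 2); first by rewrite divr_gt0.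
move=> u v au ux xv vb xdu vxd; apply/bounded_variationP; first lra.
by exists 1 => _ [s uvs <-]; apply: dP => //; lra.
Qed.

Lemma variation_cons (f : R -> R) u v c s : itv_partition u v (c :: s) ->
  variation u v f (c :: s) = `|f c - f u| + variation c v f s.
Proof.
move=> uvs; rewrite !variation_zip//; last exact: itv_partition_cons uvs.
by rewrite /= big_cons.
Qed.

(** W is the total variation of F over [a, x]. The two properties are all that the
    proof of differentiability uses of it: it dominates the increments of F, and
    partitions nearly exhaust it. *)
Lemma absolutely_continuous_on_variation_function (F : R -> R) : a <= b ->
  absolutely_continuous_on a b F ->
  exists2 W : R -> R,
    forall x y, a <= x -> x <= y -> y <= b -> `|F y - F x| <= W y - W x &
    forall e, 0 < e -> exists2 s, itv_partition a b s &
      W b - W a - e <= variation a b F s.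
Proof.
move=> ab acF.
have tvab := absolutely_continuous_on_total_variation_fin ab acF.
have bv := (bounded_variationP F ab).2 tvab.
have tvfin x y : a <= x -> x <= y -> y <= b -> total_variation x y F \is a fin_num.
  move=> ax xy yb; apply/bounded_variationP => //.
  apply: (@bounded_variationr _ a) => //.
  by apply: bounded_variationl yb bv => //; lra.
exists (fun x => fine (total_variation a x F)).
- move=> x y ax xy yb.
  rewrite /= (total_variationD F ax xy) fineD; last 2 first.
    by apply: tvfin => //; lra.
    exact: tvfin.
  rewrite addrAC subrr add0r -lee_fin fineK; first exact: total_variation_ge.
  exact: tvfin.
- move=> e e0; rewrite total_variationxx /= subr0.
  have [x [_ [s abs <-] <-]] := ub_ereal_sup_adherent e0 tvab.
  move=> lt_s; exists s => //; rewrite -lee_fin EFinB fineK//.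
  exact: ltW.
Qed.

End variation_function.

(** * Differentiability almost everywhere *)

Section differentiable_ae.
Context {R : realType}.
Local Notation mu := (@lebesgue_measure R).

Lemma negligible_of_small_covers (E : set R) :
  (forall e, 0 < e -> exists U : set R,
    [/\ measurable U, E `<=` U & (mu U <= e%:E)%E]) ->
  mu.-negligible E.
Proof.
move=> small; have n0 (n : nat) : 0 < n.+1%:R^-1 :> R by rewrite invr_gt0.
pose U n := sval (cid (small _ (n0 n))).
have UP n : [/\ measurable (U n), E `<=` U n & (mu (U n) <= n.+1%:R^-1%:E)%E].
  by rewrite /U; case: cid.
exists (\bigcap_n U n); split.
- by apply: bigcapT_measurable => n; case: (UP n).
- apply/eqP; rewrite -measure_le0; apply/lee_addgt0Pr => e e0.
  have [n ne] : exists n : nat, n.+1%:R^-1 <= e.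
    exists (Num.truncn e^-1); rewrite -[leRHS]invrK lef_pV2 ?posrE ?invr_gt0//.
    by apply/ltW; exact: truncnS_gt.
  rewrite add0e (@le_trans _ _ (mu (U n)))//.
    have mcap : measurable (\bigcap_n U n).
      by apply: bigcapT_measurable => k; case: (UP k).
    have [mUn _ _] := UP n.
    by apply: le_measure; rewrite ?inE// => x; exact.
  by have [_ _ /le_trans] := UP n; apply; rewrite lee_fin.
- by move=> x Ex n _; have [_ + _] := UP n; apply.
Qed.

Lemma negligible_bigcup_count (T : countType) (E : T -> set R) :
  (forall i, mu.-negligible (E i)) -> mu.-negligible (\bigcup_i E i).
Proof.
move=> nE; pose E' n := if choice.unpickle n is Some i then E i else set0.
apply: (@negligibleS _ _ _ mu (\bigcup_n E' n)).
  by move=> x [i _ Eix]; exists (choice.pickle i) => //; rewrite /E' choice.pickleK.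
apply: negligible_bigcup => n; rewrite /E'.
by case: (choice.unpickle n) => [i|]; [exact: nE|exact: negligible_set0].
Qed.

Definition quotient (F : R -> R) (x h : R) := h^-1 * (F (x + h) - F x).

Definition frequently0 (P : R -> Prop) :=
  forall d, 0 < d -> exists h, [/\ h != 0, `|h| < d & P h].

(** A steep interval with endpoint x is enlarged to one with x in its interior,
    which continuity of F at x allows as its slope exceeds alpha strictly. The
    steepness is then transferred to Psi, whose increments dominate. *)
Lemma mem_steep_cover (F Psi : R -> R) (u v alpha x h : R) :
  (forall s t, u <= s -> s <= t -> t <= v -> F t - F s <= Psi t - Psi s) ->
  (forall e, 0 < e -> exists2 d, 0 < d & forall y, u <= y <= v ->
    `|y - x| < d -> `|F y - F x| < e) ->
  u < x < v -> u < x + h < v -> h != 0 -> alpha < quotient F x h ->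
  steep_cover Psi u v alpha x.
Proof.
move=> FPsi cF /andP[ux xv] /andP[uxh xhv] h0 steep.
(* The amount by which the increment over the steep interval exceeds slope
   alpha. *)
pose gap := `|h| * (quotient F x h - alpha).
have gap0 : 0 < gap by rewrite mulr_gt0 ?normr_gt0// subr_gt0.
have [|d d0 dP] := cF (gap / 2); first by rewrite divr_gt0.
have a1 : 0 < `|alpha| + 1 by rewrite ltr_pwDr.
have [k k0 [kd ku kv kgap]] : exists2 k, 0 < k &
    [/\ k < d, u < x - k, x + k < v & `|alpha| * k <= gap / 2].
  exists (Num.min (Num.min d (Num.min (x - u) (v - x)) / 2)
                  (gap / 2 / (`|alpha| + 1))).
    by rewrite lt_min !divr_gt0// !lt_min d0 !subr_gt0 ux.
  set m := Num.min d _; set k := Num.min (m / 2) _.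
  have km : k <= m / 2 by rewrite ge_min lexx.
  have kg : k * (`|alpha| + 1) <= gap / 2.
    by rewrite -ler_pdivlMr// ge_min lexx orbT.
  have m0 : 0 < m by rewrite !lt_min d0 !subr_gt0 ux.
  have k0 : 0 < k by rewrite lt_min !divr_gt0.
  have md : m <= d by rewrite ge_min lexx.
  have mu' : m <= x - u by rewrite !ge_min lexx !orbT.
  have mv : m <= v - x by rewrite !ge_min lexx !orbT.
  by split; lra.
have ak : alpha * k <= gap / 2.
  by apply: le_trans kgap; rewrite ler_wpM2r ?(ltW k0)// ler_norm.
have akN : - (alpha * k) <= gap / 2.
  by apply: le_trans kgap; rewrite -mulNr ler_wpM2r ?(ltW k0)// -normrN ler_norm.
have hE : h * quotient F x h = F (x + h) - F x by rewrite /quotient mulVKf.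
(* The second endpoint is pushed past x on the side opposite to x + h, by so
   little that at most the excess slope gap is spent. *)
move: h0; rewrite neq_lt => /orP[hlt|hgt].
- have gapE : gap = alpha * h - (F (x + h) - F x).
    by rewrite -hE /gap (ltr0_norm hlt); ring.
  have := dP (x + k); rewrite (addrAC x) subrr add0r (gtr0_norm k0).
  move=> /(_ ltac:(apply/andP; split; lra) kd).
  rewrite ltr_norml => /andP[Fk _].
  exists (x + h, x + k) => /=; last by rewrite in_itv /=; apply/andP; split; lra.
  split => /=; [lra|lra|lra|].
  by apply: le_trans (FPsi _ _ _ _ _); lra.
- have gapE : gap = (F (x + h) - F x) - alpha * h.
    by rewrite -hE /gap (gtr0_norm hgt); ring.
  have := dP (x - k); rewrite (addrAC x) subrr add0r normrN (gtr0_norm k0).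
  move=> /(_ ltac:(apply/andP; split; lra) kd).
  rewrite ltr_norml => /andP[_ Fk].
  exists (x - k, x + h) => /=; last by rewrite in_itv /=; apply/andP; split; lra.
  split => /=; [lra|lra|lra|].
  by apply: le_trans (FPsi _ _ _ _ _); lra.
Qed.

End differentiable_ae.

Section oscillation.
Context {R : realType}.
Local Notation mu := (@lebesgue_measure R).

Lemma quotientN (F : R -> R) x h : quotient (fun y => - F y) x h = - quotient F x h.
Proof. by rewrite /quotient -mulrN; congr (_ * _); ring. Qed.

Lemma frequently_in (P : R -> Prop) (u v x : R) : u < x < v -> frequently0 P ->
  exists2 h, u < x + h < v /\ h != 0 & P h.
Proof.
move=> /andP[ux xv] /(_ (Num.min (x - u) (v - x)))[].
  by rewrite lt_min !subr_gt0 ux.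
move=> h [h0]; rewrite lt_min => /andP[]; rewrite !ltr_norml.
move=> /andP[h1 h2] /andP[h3 h4] Ph; exists h => //; split=> //.
by apply/andP; split; lra.
Qed.

Definition oscillating (F : R -> R) (alpha : R) : set R :=
  [set x | frequently0 (fun h => quotient F x h < - alpha) /\
           frequently0 (fun h => alpha < quotient F x h)].

Definition unbounded_quotient (F : R -> R) : set R :=
  [set x | forall n : nat, frequently0 (fun h => n.+1%:R < `|quotient F x h|)].

Variables (a b : R) (F W : R -> R).
Hypothesis ab : a <= b.
Hypothesis acF : absolutely_continuous_on a b F.
Hypothesis FW : forall x y, a <= x -> x <= y -> y <= b -> `|F y - F x| <= W y - W x.
Hypothesis WF : forall e, 0 < e -> exists2 s, itv_partition a b s &
  W b - W a - e <= variation a b F s.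

Let contF u v x : a <= u -> v <= b -> u < x < v ->
  forall e, 0 < e -> exists2 d, 0 < d & forall y, u <= y <= v ->
    `|y - x| < d -> `|F y - F x| < e.
Proof.
move=> au vb /andP[ux xv] e e0.
have [d d0 dP] := absolutely_continuous_on_continuous acF e0.
exists d => // y /andP[uy yv] yxd.
by apply: dP => //; apply/andP; split; lra.
Qed.

Let contFN u v x : a <= u -> v <= b -> u < x < v ->
  forall e, 0 < e -> exists2 d, 0 < d & forall y, u <= y <= v ->
    `|y - x| < d -> `|- F y - - F x| < e.
Proof.
move=> au vb uxv e e0; have [d d0 dP] := contF au vb uxv e0.
by exists d => // y uyv yxd; rewrite -opprD normrN; exact: dP.
Qed.

Let domF s t : a <= s -> s <= t -> t <= b ->
  F t - F s <= W t - W s /\ - F t - - F s <= W t - W s.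
Proof.
move=> as_ st tb; have := FW as_ st tb.
by rewrite ler_norml => /andP[? ?]; split; lra.
Qed.

(** If F does not decrease from u to v, a descent of slope - alpha makes W - F
    climb at slope alpha, since W never decreases; and W - F has only
    (W v - W u) - (F v - F u) to climb. If F decreases, use ascents and W + F. *)
Lemma oscillating_interval (u v alpha : R) : 0 < alpha -> a <= u -> u < v -> v <= b ->
  exists U : set R, [/\ measurable U,
    [set x | u < x < v] `&` oscillating F alpha `<=` U &
    (mu U <= (3 * (W v - W u - `|F v - F u|) / alpha)%:E)%E].
Proof.
move=> alpha0 au uv vb; have [Fuv|Fvu] := leP (F u) (F v).
- exists (steep_cover (fun x => W x - F x) u v alpha); split.
  + exact: steep_cover_measurable.
  + move=> x [uxv [oscN _]].
    have [h [uxh h0] qh] := frequently_in uxv oscN.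
    apply: (mem_steep_cover (F := fun x => - F x) _ _ uxv uxh h0).
    * by move=> s t us st tv; have [] := @domF s t ltac:(lra) st ltac:(lra); lra.
    * exact: (contFN au vb uxv).
    * by rewrite quotientN; lra.
  + rewrite ger0_norm ?subr_ge0//.
    have -> : W v - W u - (F v - F u) = (W v - F v) - (W u - F u) by ring.
    apply: (@maximal_steep_cover _ (fun x => W x - F x)) => //; first exact: ltW.
    move=> x y ux xy yv.
    by have [] := @domF x y ltac:(lra) xy ltac:(lra); lra.
- exists (steep_cover (fun x => W x + F x) u v alpha); split.
  + exact: steep_cover_measurable.
  + move=> x [uxv [_ osc]].
    have [h [uxh h0] qh] := frequently_in uxv osc.
    apply: (mem_steep_cover (F := F) _ _ uxv uxh h0 qh).
    * by move=> s t us st tv; have [] := @domF s t ltac:(lra) st ltac:(lra); lra.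
    * exact: (contF au vb uxv).
  + rewrite ltr0_norm ?subr_lt0//.
    have -> : W v - W u - - (F v - F u) = (W v + F v) - (W u + F u) by ring.
    apply: (@maximal_steep_cover _ (fun x => W x + F x)) => //; first exact: ltW.
    move=> x y ux xy yv.
    by have [] := @domF x y ltac:(lra) xy ltac:(lra); lra.
Qed.

(** Summed over a partition, the bounds of [oscillating_interval] leave the total
    variation minus the variation along that partition. *)
Lemma oscillating_partition (s : seq R) (u alpha : R) : 0 < alpha -> a <= u ->
  itv_partition u b s ->
  exists U : set R, [/\ measurable U,
    [set x | u <= x <= b] `&` oscillating F alpha `<=` U &
    (mu U <= (3 * (W b - W u - variation u b F s) / alpha)%:E)%E].
Proof.
move=> alpha0; elim: s u => [|c s IHs] u au us.
  have ub : u = b := itv_partition_nil us.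
  exists [set u]; split; first exact: measurable_set1.
    by move=> x [/= + _]; rewrite -ub -eq_le => /eqP.
  by rewrite lebesgue_measure_set1 /variation big_nil ub subrr subr0 mulr0 mul0r.
have csb := itv_partition_cons us.
have cb := itv_partition_le csb.
have uc : u < c by case: us => /= /andP[].
have [U [mU oU muU]] := oscillating_interval alpha0 au uc cb.
have [|V [mV oV muV]] := IHs c _ csb; first lra.
exists ([set u] `|` U `|` V); split.
- by do ![apply: measurableU] => //; exact: measurable_set1.
- move=> x [/= /andP[ux xb] oscx].
  have [cx|xc] := leP c x; first by right; apply: oV; split=> //=; rewrite cx.
  left; move: ux; rewrite le_eqVlt => /predU1P[->|ux]; first by left.
  by right; apply: oU; split=> //=; rewrite ux.
- rewrite (variation_cons _ us).
  apply: (@le_trans _ _ (mu U + mu V)%E).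
    apply: (le_trans (measureU2 _ _ _)) => //.
      by apply: measurableU => //; exact: measurable_set1.
    rewrite leeD2r//; apply: (le_trans (measureU2 _ _ _)) => //.
    by rewrite -[leRHS]add0e -(lebesgue_measure_set1 u).
  apply: (le_trans (leeD muU muV)); rewrite -EFinD lee_fin -mulrDl.
  by rewrite ler_wpM2r ?invr_ge0 ?(ltW alpha0)//; lra.
Qed.

Lemma oscillating_negligible (alpha : R) : 0 < alpha ->
  mu.-negligible ([set x | a <= x <= b] `&` oscillating F alpha).
Proof.
move=> alpha0; apply: negligible_of_small_covers => e e0.
have [|s abs Ws] := WF (_ : 0 < e * alpha / 3); first by rewrite divr_gt0// mulr_gt0.
have [U [mU oU muU]] := oscillating_partition alpha0 (lexx a) abs.
exists U; split => //; apply: (le_trans muU).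
by rewrite lee_fin ler_pdivrMr//; lra.
Qed.

(** Slopes beyond n force W to climb at slope n on a set which, by the maximal
    inequality, has measure O(1 / n). *)
Lemma unbounded_quotient_negligible :
  mu.-negligible ([set x | a < x < b] `&` unbounded_quotient F).
Proof.
apply: negligible_of_small_covers => e e0.
have W0 : 0 <= W b - W a by rewrite (le_trans _ (FW (lexx a) ab (lexx b))).
pose n := Num.truncn (e^-1 * (3 * (W b - W a))).
exists (steep_cover W a b n.+1%:R); split.
- exact: steep_cover_measurable.
- move=> x [axb /(_ n) fx]; have [h [axh h0]] := frequently_in axb fx.
  rewrite lter_normr => /orP[qh|qh].
  + apply: (mem_steep_cover (F := F) _ _ axb axh h0 qh); last exact: (contF (lexx a) (lexx b) axb).
    by move=> s t as_ st tb; have [] := domF as_ st tb.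
  + apply: (mem_steep_cover (F := fun x => - F x) _ _ axb axh h0).
    * by move=> s t as_ st tb; have [] := domF as_ st tb.
    * exact: (contFN (lexx a) (lexx b) axb).
    * by rewrite quotientN.
- apply: (le_trans (maximal_steep_cover _ _ _)) => //.
    by move=> x y ax xy yb; rewrite -subr_ge0 (le_trans _ (FW ax xy yb)).
  rewrite lee_fin ler_pdivrMr// -ler_pdivrMl//.
  by apply/ltW; exact: truncnS_gt.
Qed.

End oscillation.

Section derivable_ae.
Context {R : realType}.
Local Notation mu := (@lebesgue_measure R).

Lemma not_frequently0 (P : R -> Prop) : ~ frequently0 P ->
  exists2 d, 0 < d & forall h, h != 0 -> `|h| < d -> ~ P h.
Proof.
move=> /existsNP[d /not_implyP[d0 NP]]; exists d => // h h0 hd Ph.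
by apply: NP; exists h.
Qed.

Lemma quotient_sub_linear (F : R -> R) m x h : h != 0 ->
  quotient (fun y => F y - m * y) x h = quotient F x h - m.
Proof. by move=> h0; rewrite /quotient; field. Qed.

(** The limit is the supremum of the eventual lower bounds of the quotient. Were
    the quotient to stay frequently above it by a fixed amount, it would oscillate
    between two rationals p < q; subtracting the line of slope (p + q) / 2 makes
    the oscillation symmetric. *)
Lemma derivable_quotient (F : R -> R) x :
  ~ unbounded_quotient F x ->
  (forall p q : rat, ratr p < ratr q :> R ->
    ~ oscillating (fun y => F y - (ratr p + ratr q) / 2 * y)
        ((ratr q - ratr p) / 2) x) ->
  derivable F x 1.
Proof.
move=> /existsNP[n /not_frequently0[d d0 dN]] noosc.
pose S := [set p | exists2 d, 0 < d & forall h, h != 0 -> `|h| < d ->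
  p <= quotient F x h].
have SN : S (- n.+1%:R).
  exists d => // h h0 hd; have /negP := dN h h0 hd.
  by rewrite -leNgt ler_norml => /andP[].
have ubS : ubound S n.+1%:R.
  move=> p [d' d'0 pd'].
  pose h := Num.min d d' / 2.
  have h0 : 0 < h by rewrite divr_gt0// lt_min d0.
  have hd : h < d by rewrite /h ltr_pdivrMr// gt_min; apply/orP; left; lra.
  have hd' : h < d' by rewrite /h ltr_pdivrMr// gt_min; apply/orP; right; lra.
  have := dN h (lt0r_neq0 h0); rewrite (gtr0_norm h0) => /(_ hd) /negP.
  rewrite -leNgt ler_norml => /andP[_]; apply: le_trans.
  by apply: pd'; rewrite ?gt_eqF// gtr0_norm.
have supS : has_sup S by split; [exists (- n.+1%:R)|exists n.+1%:R].
have lim e : 0 < e -> exists2 d, 0 < d & forall h, h != 0 -> `|h| < d ->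
    `|sup S - quotient F x h| <= e.
  move=> e0; have [p [d1 d10 pd1] ep] := sup_adherent e0 supS.
  have [p1] : exists p, ratr p \in `]sup S, sup S + e[ by apply: rat_in_itvoo; lra.
  rewrite in_itv/= => /andP[Sp1 p1e].
  have [p2] := rat_in_itvoo p1e; rewrite in_itv/= => /andP[p12 p2e].
  have /not_andP[|] := noosc _ _ p12 => /not_frequently0[d2 d20 qd2].
    have : S (ratr p1).
      exists d2 => // h h0 hd; have /negP := qd2 h h0 hd.
      by rewrite -leNgt quotient_sub_linear//; lra.
    by move=> /(ub_le_sup (ex_intro _ _ ubS)); lra.
  exists (Num.min d1 d2); first by rewrite lt_min d10.
  move=> h h0; rewrite lt_min => /andP[hd1 hd2].
  have := pd1 h h0 hd1; have /negP := qd2 h h0 hd2.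
  rewrite -leNgt quotient_sub_linear// ler_norml => ? ?.
  by apply/andP; split; lra.
apply: (cvgP (sup S)); apply/cvgrPdist_le => e e0.
have [d1 d10 ed1] := lim e e0.
near=> h.
have -> : h^-1 *: ((F \o shift x) (h *: 1) - F x) = quotient F x h.
  by rewrite /quotient /= /GRing.scale /= mulr1 (addrC h).
apply: ed1; first by near: h; exact: nbhs_dnbhs_neq.
by near: h; exact: dnbhs0_lt.
Unshelve. all: by end_near. Qed.

(** By [derivable_quotient], a point where F is not derivable has unbounded quotients
    or an oscillation between two rationals, so it lies in one of countably many
    null sets. *)
Lemma absolutely_continuous_on_derivable_ae (a b : R) (F : R -> R) : a <= b ->
  absolutely_continuous_on a b F ->
  mu.-negligible [set x | a < x < b /\ ~ derivable F x 1].
Proof.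
move=> ab acF.
pose E (pq : rat * rat) : set R := [set x | a <= x <= b] `&`
  [set x | ratr pq.1 < ratr pq.2 :> R /\
    oscillating (fun y => F y - (ratr pq.1 + ratr pq.2) / 2 * y)
        ((ratr pq.2 - ratr pq.1) / 2) x].
apply: (@negligibleS _ _ _ mu
    (([set x | a < x < b] `&` unbounded_quotient F) `|` \bigcup_pq E pq)).
  move=> x [axb ndF]; apply: contrapT => /not_orP[nub nosc]; apply: ndF.
  apply: derivable_quotient => [ub|p q pq osc]; first by apply: nub.
  apply: nosc; exists (p, q) => //; split => //=.
  by case/andP: axb => /ltW -> /ltW ->.
apply: negligibleU.
  have [W FW WF] := absolutely_continuous_on_variation_function ab acF.
  exact: unbounded_quotient_negligible FW.
apply: negligible_bigcup_count => -[p q]; rewrite /E /=.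
have [pq|qp] := ltP (ratr p : R) (ratr q); last first.
  by apply: negligibleS (negligible_set0 _) => x [_ []].
set G := fun y => F y - _; have acG : absolutely_continuous_on a b G.
  by apply: absolutely_continuous_onB => //; exact: absolutely_continuous_on_linear.
have [W GW WG] := absolutely_continuous_on_variation_function ab acG.
have alpha0 : 0 < (ratr q - ratr p) / 2 :> R by rewrite divr_gt0// subr_gt0.
apply: negligibleS (oscillating_negligible acG GW WG alpha0).
by move=> x [? []].
Qed.

End derivable_ae.

(** * Lipschitz bounds from almost everywhere bounds on the derivative *)

Section lipschitz.
Context {R : realType}.
Local Notation mu := (@lebesgue_measure R).

Lemma derivable_linear_approx (F : R -> R) x : derivable F x 1 ->
  forall e, 0 < e -> exists2 d, 0 < d & forall y, `|y - x| < d ->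
    `|F y - F x - F^`()%classic x * (y - x)| <= e * `|y - x|.
Proof.
move=> dF e e0; have : derivable F x 1 := dF.
rewrite /derivable => /cvgrPdist_le /(_ e e0)[d /= d0 dP].
exists d => // y yxd; have [->|yx] := eqVneq y x.
  by rewrite !subrr mulr0 subr0 normr0 mulr0.
have yx0 : y - x != 0 by rewrite subr_eq0.
have := dP (y - x); rewrite /ball_ /= sub0r normrN => /(_ yxd yx0).
rewrite /GRing.scale /= mulr1 subrK derive1E => le_e.
rewrite -[X in `|X|](_ : (y - x) * ((y - x)^-1 * (F y - F x) - 'D_1 F x) = _).
  by rewrite normrM mulrC ler_wpM2r// distrC.
by field.
Qed.


Local Notation chain := (pairwise (fun p q : R * R => p.2 <= q.1)).

Lemma chain_trivIset (l : seq (R * R)) : chain l ->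
  trivIset [set: 'I_(size l)]
    (fun i => [set` `](nth (0, 0) l i).1, (nth (0, 0) l i).2[ ]).
Proof.
move=> /(pairwiseP (0, 0)) ch i j _ _ [x []].
rewrite /= !in_itv /= => /andP[ix xi] /andP[jx xj].
apply/val_inj/eqP; rewrite eqn_leq leqNgt [X in _ && X]leqNgt.
apply/andP; split; apply/negP => ij.
- by have := ch j i (ltn_ord j) (ltn_ord i) ij; lra.
- by have := ch i j (ltn_ord i) (ltn_ord j) ij; lra.
Qed.

Lemma chain_length_le (l : seq (R * R)) (U : set R) : measurable U -> chain l ->
  (forall p, p \in l -> p.1 <= p.2 /\ `]p.1, p.2[ `<=` U) ->
  ((\sum_(p <- l) (p.2 - p.1))%:E <= mu U)%E.
Proof.
move=> mU ch lU.
pose I (i : 'I_(size l)) : set R := `](nth (0, 0) l i).1, (nth (0, 0) l i).2[%classic.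
have mI i : measurable (I i) by exact: measurable_itv.
apply: (@le_trans _ _ (mu (\big[setU/set0]_(i < size l) I i))); last first.
  apply: le_measure; rewrite ?inE//.
    by apply: bigsetU_measurable => i _; exact: mI.
  elim/big_ind: _ => [//|A B AU BU|i _]; first by rewrite subUset.
  exact: (lU _ (mem_nth (0, 0) (ltn_ord i))).2.
rewrite measure_semi_additive_ord//; last 2 first.
- exact: chain_trivIset.
- by apply: bigsetU_measurable => i _; exact: mI.
rewrite (big_nth (0, 0)) big_mkord -sumEFin; apply: lee_sum => i _.
rewrite -[leRHS]/(lebesgue_measure (I i)) /I lebesgue_measure_itv /= lte_fin.
have [+ _] := lU _ (mem_nth (0, 0) (ltn_ord i)).
rewrite le_eqVlt => /predU1P[->|->].
  by rewrite subrr; case: ifP => _ //; rewrite -EFinB subrr.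
by rewrite EFinB.
Qed.

Lemma absolutely_continuous_on_chain (a b : R) (F : R -> R) e :
  absolutely_continuous_on a b F -> 0 < e -> exists2 d, 0 < d &
    forall l : seq (R * R), chain l ->
      (forall p, p \in l -> [/\ a <= p.1, p.1 <= p.2 & p.2 <= b]) ->
      \sum_(p <- l) (p.2 - p.1) < d -> \sum_(p <- l) `|F p.2 - F p.1| < e.
Proof.
move=> acF e0; have [d d0 dP] := acF e e0; exists d => // l ch lab.
rewrite !(big_nth (0, 0)) !big_mkord; apply: dP; last exact: chain_trivIset.
by move=> i; apply: lab; exact: mem_nth.
Qed.

(** Cousin's lemma is applied to the property that the increment over [s, t] is at
    most (M + e) (t - s) up to the increments over a chain of intervals inside an
    open set U of measure less than d that covers N. Points outside N need no
    chain; around a point of N the interval itself is a chain. Absolute continuity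
    bounds what the final chain contributes by e. *)
Lemma lipschitz_of_derivative_bound_ae (a b M : R) (F : R -> R) (N : set R) :
  0 <= M -> absolutely_continuous_on a b F -> mu.-negligible N ->
  (forall x, a <= x <= b -> ~ N x -> forall e, 0 < e -> exists2 d, 0 < d &
    forall y, a <= y <= b -> `|y - x| < d -> `|F y - F x| <= (M + e) * `|y - x|) ->
  forall u v, a <= u -> u <= v -> v <= b -> `|F v - F u| <= M * (v - u).
Proof.
move=> M0 acF [N' [mN' N'0 NN']] good u v au uv vb.
apply/ler_addgt0Pr => e' e'0.
pose e := e' / (v - u + 1).
have vu1 : 0 < v - u + 1 by lra.
have e0 : 0 < e by rewrite divr_gt0.
have -> : e' = e * (v - u + 1) by rewrite /e divfK// gt_eqF.
have [d d0 dP] := absolutely_continuous_on_chain acF e0.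
have [|U [oU N'U UN']] := lebesgue_regularity_outer mN' _ d0; first by rewrite [ltLHS]N'0.
have mU : measurable U := open_measurable oU.
have Ud : (mu U < d%:E)%E.
  rewrite (_ : U = N' `|` (U `\` N')); last by rewrite setDUK.
  apply: le_lt_trans (measureU2 _ _ _) _ => //; first exact: measurableD.
  by rewrite [X in (X + _)%E]N'0 add0e.
pose P s t := exists l : seq (R * R), [/\ chain l,
  (forall p, p \in l -> [/\ s <= p.1, p.1 <= p.2, p.2 <= t & `]p.1, p.2[ `<=` U]) &
  `|F t - F s| <= (M + e) * (t - s) + \sum_(p <- l) `|F p.2 - F p.1|].
have [l [ch lU le_l]] : P u v.
  apply: cousin => //.
  - move=> s w t us sw wt tv [l [lc lP le_l]] [m [mc mP le_m]].
    exists (l ++ m); split.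
    + rewrite pairwise_cat lc mc !andbT; apply/allrelP => p q /lP[_ _ pw _].
      by move=> /mP[wq _ _ _]; exact: le_trans wq.
    + move=> p; rewrite mem_cat => /orP[/lP[? ? ? ?]|/mP[? ? ? ?]]; split => //.
        by apply: le_trans wt.
      by apply: le_trans sw _.
    + rewrite big_cat /=.
      have -> : F t - F s = (F t - F w) + (F w - F s) by ring.
      by apply: le_trans (ler_normD _ _) _; lra.
  - move=> x /andP[ux xv]; have [Nx|Nx] := pselect (N x).
      have [d' /= d'0 dU] : nbhs x U by apply: open_nbhs_nbhs; split => //; exact/N'U/NN'.
      exists d' => // s t us sx xt tv sd td; exists [:: (s, t)]; split => //.
        move=> p; rewrite inE => /eqP -> /=; split => //; first lra.
        move=> y; rewrite /= in_itv /= => /andP[sy yt]; apply: dU.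
        by rewrite /ball_ /= ltr_norml; apply/andP; split; lra.
      by rewrite big_seq1 /= lerDr mulr_ge0//; lra.
    have [|d' d'0 d'P] := good x _ Nx e e0; first by apply/andP; split; lra.
    exists d' => // s t us sx xt tv sd td; exists [::]; split => //.
    rewrite big_nil addr0.
    have -> : F t - F s = (F t - F x) - (F s - F x) by ring.
    have Ft : `|F t - F x| <= (M + e) * (t - x).
      have := d'P t; rewrite (ger0_norm (_ : 0 <= t - x)) ?subr_ge0// ltrBlDl.
      by apply => //; rewrite (le_trans tv vb) (le_trans au)// (le_trans ux).
    have Fs : `|F s - F x| <= (M + e) * (x - s).
      have := d'P s; rewrite distrC (ger0_norm (_ : 0 <= x - s)) ?subr_ge0//.
      rewrite ltrBlDl -ltrBlDr; apply => //.
      by rewrite (le_trans au us) (le_trans sx)// (le_trans xv).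
    apply: le_trans (ler_normB _ _) (le_trans (lerD Ft Fs) _).
    by rewrite -mulrDr addrA subrK.
have lt_e : \sum_(p <- l) `|F p.2 - F p.1| < e.
  apply: dP => //; first by move=> p /lU[? ? ? _]; split => //; lra.
  rewrite -lte_fin; apply: le_lt_trans Ud; apply: chain_length_le => //.
  by move=> p /lU[].
by lra.
Qed.

End lipschitz.

(** * Absolute continuity of the least concave majorant *)

Section concave_ac.
Context {R : realType}.

Lemma concave_chord (a b : R) Phi x y z : concave_on a b Phi ->
  a <= x -> x <= y -> y <= z -> z <= b ->
  Phi x * (z - y) + Phi z * (y - x) <= Phi y * (z - x).
Proof.
move=> /concave_onP cPhi ax xy yz zb.
have [xz|zx] := ltP x z; last first.
  have -> : z = x by lra.
  by have -> : y = x; lra.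
have xz0 : 0 < z - x by lra.
pose t := (z - y) / (z - x).
have tE : t * (z - x) = z - y by rewrite /t divfK// gt_eqF.
have t01 : 0 <= t <= 1.
  by rewrite /t ler_pdivlMr// mul0r ler_pdivrMr// mul1r; apply/andP; split; lra.
have yE : t * x + (1 - t) * z = y.
  have -> : t * x + (1 - t) * z = z - t * (z - x) by ring.
  by rewrite tE; ring.
have := cPhi x z t ltac:(apply/andP; split; lra) ltac:(apply/andP; split; lra) t01.
rewrite yE => /(ler_wpM2r (ltW xz0)); apply: le_trans.
rewrite (_ : y - x = (z - x) - (z - y)); last by ring.
by rewrite -tE le_eqVlt; apply/orP; left; apply/eqP; ring.
Qed.

Lemma concave_slope (a b : R) Phi x y z w : concave_on a b Phi ->
  a <= x -> x <= y -> y <= z -> z <= w -> w <= b ->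
  (Phi w - Phi z) * (y - x) <= (Phi y - Phi x) * (w - z).
Proof.
move=> cPhi ax xy yz zw wb.
have [xw|wx] := ltP x w; last first.
  have -> : w = x by lra.
  have -> : z = x by lra.
  by have -> : y = x; lra.
have y_chord := concave_chord cPhi ax xy (le_trans yz zw) wb.
have z_chord := concave_chord cPhi ax (le_trans xy yz) zw wb.
have xw0 : 0 < w - x by lra.
rewrite -(ler_pM2r xw0).
have h1 : (Phi w - Phi x) * (y - x) * (w - z) <= (Phi y - Phi x) * (w - x) * (w - z).
  by rewrite ler_wpM2r ?subr_ge0//; lra.
have h2 : (Phi w - Phi z) * (w - x) * (y - x) <= (Phi w - Phi x) * (w - z) * (y - x).
  by rewrite ler_wpM2r ?subr_ge0//; lra.
by lra.
Qed.

(** Near a a concave function may climb steeply, but the climb up to a nearby c is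
    small by upper semicontinuity: theta records it, after a line of slope k0 has
    been subtracted to make it monotone. Beyond c the slope is at most that of the
    chord from a to c. *)
Lemma concave_increment (a b : R) Phi : a < b -> concave_on a b Phi ->
  (forall e, 0 < e -> exists2 d, 0 < d &
    forall x, a <= x <= b -> `|x - a| < d -> Phi x <= Phi a + e) ->
  forall e, 0 < e -> exists theta K, [/\ 0 <= K,
    (forall x y, a <= x -> x <= y -> y <= b -> theta x <= theta y),
    theta b - theta a <= e &
    forall u v, a <= u -> u <= v -> v <= b ->
      Phi v - Phi u <= theta v - theta u + K * (v - u)].
Proof.
move=> ab cPhi usc e e0.
have [|d d0 dP] := usc (e / 2); first by rewrite divr_gt0.
pose m := (a + b) / 2.
have [am mb] : a < m /\ m < b by rewrite /m; split; lra.
pose k0 := (Phi b - Phi m) / (b - m).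
have k0E : k0 * (b - m) = Phi b - Phi m by rewrite divfK// gt_eqF// subr_gt0.
have k01 : 0 < `|k0| + 1 by rewrite ltr_pwDr.
have [c ac [cm cd ck]] : exists2 c, a < c &
    [/\ c <= m, c - a < d & (c - a) * (`|k0| + 1) <= e / 2].
  exists (a + Num.min (Num.min (d / 2) (m - a)) (e / 2 / (`|k0| + 1))).
    by rewrite ltrDl !lt_min !divr_gt0// subr_gt0 am.
  split.
  - by rewrite -lerBrDl !ge_min lexx orbT.
  - by rewrite addrAC subrr add0r !gt_min; apply/orP; left; apply/orP; left; lra.
  - by rewrite addrAC subrr add0r -ler_pdivlMr// !ge_min lexx orbT.
pose k1 := (Phi c - Phi a) / (c - a).
have k1E : k1 * (c - a) = Phi c - Phi a by rewrite divfK// gt_eqF// subr_gt0.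
have left_slope x y : a <= x -> x <= y -> y <= c -> k0 * (y - x) <= Phi y - Phi x.
  move=> ax xy yc; have bm0 : 0 < b - m by lra.
  rewrite -(ler_pM2r bm0) mulrAC k0E.
  by apply: concave_slope cPhi _ _ _ _ _ => //; lra.
have right_slope x y : c <= x -> x <= y -> y <= b -> Phi y - Phi x <= k1 * (y - x).
  move=> cx xy yb; have ca0 : 0 < c - a by lra.
  rewrite -(ler_pM2r ca0) [leRHS]mulrAC k1E.
  by apply: concave_slope cPhi _ _ _ _ _ => //; lra.
have cb : c <= b by lra.
have min_le x y : x <= y -> Num.min x c <= Num.min y c.
  by move=> xy; rewrite le_min !ge_min xy lexx orbT.
have le0 (k x : R) : 0 <= x -> k * x <= `|k| * x.
  by move=> x0; apply: ler_wpM2r => //; exact: ler_norm.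
exists (fun x => Phi (Num.min x c) - k0 * Num.min x c), (`|k0| + `|k1|).
split; first by rewrite addr_ge0.
- move=> x y ax xy yb.
  have := left_slope (Num.min x c) (Num.min y c).
  by rewrite le_min ax (ltW ac) min_le// !ge_min lexx orbT => /(_ isT isT isT); lra.
- rewrite (min_r cb) (min_l (ltW ac)).
  have := dP c; rewrite (ltW ac) cb gtr0_norm ?subr_gt0// => /(_ isT cd).
  by have := le0 (- k0) (c - a); rewrite normrN subr_ge0 (ltW ac) => /(_ isT); lra.
- move=> u v au uv vb.
  have below x y : a <= x -> x <= y -> y <= c -> Phi y - Phi x <=
      Phi y - k0 * y - (Phi x - k0 * x) + (`|k0| + `|k1|) * (y - x).
    move=> ax xy yc; have := le0 k0 (y - x); rewrite subr_ge0 => /(_ xy).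
    have : 0 <= `|k1| * (y - x) by rewrite mulr_ge0// subr_ge0.
    by lra.
  have above x y : c <= x -> x <= y -> y <= b ->
      Phi y - Phi x <= (`|k0| + `|k1|) * (y - x).
    move=> cx xy yb; have := right_slope _ _ cx xy yb.
    have := le0 k1 (y - x); rewrite subr_ge0 => /(_ xy).
    have : 0 <= `|k0| * (y - x) by rewrite mulr_ge0// subr_ge0.
    by lra.
  have [vc|cv] := leP v c.
    by rewrite !min_l// ?(le_trans uv)//; exact: below.
  have [cu|uc] := leP c u.
    by rewrite subrr add0r; exact: above.
  by have := below u c au (ltW uc) (lexx c); have := above c v (lexx c) (ltW cv) vb; lra.
Qed.

Lemma concave_on_reflect (a b : R) Phi : concave_on a b Phi ->
  concave_on a b (fun x => Phi (a + b - x)).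
Proof.
move=> /concave_onP cPhi; apply/concave_onP => x y t /andP[ax xb] /andP[ay yb] t01.
have -> : a + b - (t * x + (1 - t) * y) =
  t * (a + b - x) + (1 - t) * (a + b - y) by ring.
by apply: cPhi => //; apply/andP; split; lra.
Qed.

(** [concave_increment] bounds upward increments; applied to the reflected function
    it bounds downward ones. The increments of theta over disjoint intervals sum to
    at most its total, and the linear term is small with the total length. *)
Lemma concave_absolutely_continuous (a b : R) Phi : a < b -> concave_on a b Phi ->
  (forall z, z = a \/ z = b -> forall e, 0 < e -> exists2 d, 0 < d &
    forall x, a <= x <= b -> `|x - z| < d -> Phi x <= Phi z + e) ->
  absolutely_continuous_on a b Phi.
Proof.
move=> ab cPhi usc e e0.
have e4 : 0 < e / 4 by rewrite divr_gt0.
have [theta1 [K1 [K10 mono1 tot1 inc1]]] := concave_increment ab cPhi (usc a (or_introl erefl)) e4.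
have [|theta2 [K2 [K20 mono2 tot2 inc2]]] :=
    concave_increment ab (concave_on_reflect cPhi) _ e4.
  move=> e' e'0; have [d d0 dP] := usc b (or_intror erefl) e' e'0.
  exists d => // x /andP[ax xb] xad; rewrite (_ : a + b - a = b); last by ring.
  apply: dP; first by apply/andP; split; lra.
  by rewrite (_ : a + b - x - b = - (x - a)) ?normrN//; ring.
pose theta x := theta1 x - theta2 (a + b - x).
have mono x y : a <= x -> x <= y -> y <= b -> theta x <= theta y.
  move=> ax xy yb; have := mono1 x y ax xy yb.
  have := mono2 (a + b - y) (a + b - x) ltac:(lra) ltac:(lra) ltac:(lra).
  by rewrite /theta; lra.
have tot : theta b - theta a <= e / 2.
  rewrite /theta (_ : a + b - b = a); last by ring.
  by rewrite (_ : a + b - a = b); [lra|ring].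
have inc u v : a <= u -> u <= v -> v <= b ->
    `|Phi v - Phi u| <= theta v - theta u + (K1 + K2) * (v - u).
  move=> au uv vb; have up := inc1 u v au uv vb.
  have := inc2 (a + b - v) (a + b - u) ltac:(lra) ltac:(lra) ltac:(lra).
  have shift x : a + b - (a + b - x) = x by ring.
  rewrite !shift => down.
  have m1 := mono1 u v au uv vb.
  have m2 := mono2 (a + b - v) (a + b - u) ltac:(lra) ltac:(lra) ltac:(lra).
  have h1 : 0 <= K1 * (v - u) by rewrite mulr_ge0// subr_ge0.
  have h2 : 0 <= K2 * (v - u) by rewrite mulr_ge0// subr_ge0.
  have {}down : Phi u - Phi v <=
    theta2 (a + b - u) - theta2 (a + b - v) + K2 * (v - u) by lra.
  by rewrite /theta ler_norml; apply/andP; split; lra.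
have K0 : 0 < K1 + K2 + 1 by lra.
exists (e / 2 / (K1 + K2 + 1)); first by rewrite !divr_gt0.
move=> n u v uv tuv; rewrite ltr_pdivlMr// => len.
have len0 : 0 <= \sum_(i < n) (v i - u i).
  by apply: sumr_ge0 => i _; have [_ + _] := uv i; rewrite subr_ge0.
apply: (@le_lt_trans _ _ (\sum_(i < n) (theta (v i) - theta (u i)) +
    (K1 + K2) * \sum_(i < n) (v i - u i))).
  rewrite mulr_sumr -big_split/=; apply: ler_sum => i _.
  by have [? ? ?] := uv i; exact: inc.
have : \sum_(i < n) (theta (v i) - theta (u i)) <= theta b - theta a.
  apply: sum_increments_le => //.
  - exact: ltW.
  - by move=> i _; have [] := uv i.
  - by move=> i _ _; have [] := uv i.
  - exact: index_enum_uniq.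
  - exact: sub_trivIset tuv.
by lra.
Qed.

End concave_ac.

Section majorant_ac.
Context {R : realType} (a b : R).

(** The affine function F z + e / 2 + k |x - z| majorizes F once k is large. The sign
    sigma lets one statement serve both endpoints: it is what makes |x - z| affine
    on [a, b]. *)
Lemma least_concave_majorant_usc (F : R -> R) (B z sigma : R) :
  (forall x, a <= x <= b -> F x <= B) -> a <= z <= b ->
  (forall x, a <= x <= b -> `|x - z| = sigma * (x - z)) ->
  (forall e, 0 < e -> exists2 d, 0 < d &
    forall x, a <= x <= b -> `|x - z| < d -> F x <= F z + e) ->
  forall e, 0 < e -> exists2 d, 0 < d & forall x, a <= x <= b -> `|x - z| < d ->
    least_concave_majorant a b F x <= least_concave_majorant a b F z + e.
Proof.
move=> FB zab zE usc e e0.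
have [|d d0 dP] := usc (e / 2); first by rewrite divr_gt0.
pose k := `|B - F z| / d.
have kd : k * d = `|B - F z| by rewrite divfK// gt_eqF.
have k0 : 0 <= k by rewrite divr_ge0// ltW.
have k1 : 0 < k + 1 by lra.
have maj x : a <= x <= b ->
    least_concave_majorant a b F x <= F z + e / 2 + k * `|x - z|.
  move=> xab; rewrite zE// mulrA.
  apply: (@least_concave_majorant_le _ _ _ F (fun x => F z + e / 2 + k * sigma * (x - z))) => //.
    move=> y yab; rewrite -mulrA -zE//.
    have [yd|dy] := ltP `|y - z| d.
      have kyz : 0 <= k * `|y - z| by rewrite mulr_ge0.
      by have := dP y yab yd; lra.
    have := ler_wpM2l k0 dy; rewrite kd.
    by have := FB y yab; have := ler_norm (B - F z); lra.
  exact: concave_on_affine.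
exists (e / 2 / (k + 1)); first by rewrite !divr_gt0.
move=> x xab; rewrite ltr_pdivlMr// => xz.
have := le_least_concave_majorant FB zab; have := maj x xab.
have := normr_ge0 (x - z); lra.
Qed.

Lemma absolutely_continuous_on_bounded (F : R -> R) : a <= b ->
  absolutely_continuous_on a b F ->
  exists B, forall x, a <= x <= b -> F x <= B.
Proof.
move=> ab acF; have [W FW _] := absolutely_continuous_on_variation_function ab acF.
exists (F a + (W b - W a)) => x /andP[ax xb].
have := FW a x (lexx a) ax xb; have := FW x b ax xb (lexx b).
have := normr_ge0 (F b - F x); have := ler_norm (F x - F a); lra.
Qed.

Lemma least_concave_majorant_absolutely_continuous (F : R -> R) : a < b ->
  absolutely_continuous_on a b F ->
  absolutely_continuous_on a b (least_concave_majorant a b F).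
Proof.
move=> ab acF; have [B FB] := absolutely_continuous_on_bounded (ltW ab) acF.
apply: concave_absolutely_continuous => //.
  exact: least_concave_majorant_concave FB.
move=> z zab.
have z_in : a <= z <= b by case: zab => ->; rewrite lexx (ltW ab).
have [sigma sigmaE] : exists sigma, forall x, a <= x <= b -> `|x - z| = sigma * (x - z).
  case: zab => ->.
    by exists 1 => x /andP[ax _]; rewrite mul1r ger0_norm// subr_ge0.
  by exists (-1) => x /andP[_ xb]; rewrite mulN1r ler0_norm// subr_le0.
apply: (least_concave_majorant_usc FB z_in sigmaE) => e e0.
have [d d0 dP] := absolutely_continuous_on_continuous acF e0.
exists d => // x xab xz; have := dP z x z_in xab xz.
by have := ler_norm (F x - F z); lra.
Qed.

End majorant_ac.

(** * The essential supremum norm and the level functions *)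

Section Linfty.
Context {R : realType}.
Local Notation mu := (@lebesgue_measure R).

Lemma Linfty_norm_le (a b M : R) (h : R -> R) (N : set R) :
  0 <= M -> mu.-negligible N ->
  (forall x, a <= x <= b -> ~ N x -> `|h x| <= M) ->
  (Linfty_norm a b h <= M%:E)%E.
Proof.
move=> M0 [N' [mN' N'0 NN']] hM; rewrite /Linfty_norm unlock /=.
case: ifPn => [_|_]; last by rewrite lee_fin.
apply/ess_supP; exists (N' `|` ~` [set` `[a, b]]); split.
- by apply: measurableU => //; apply: measurableC; exact: measurable_itv.
- rewrite -[LHS]/(mu ((N' `|` ~` [set` `[a, b]]) `&` [set` `[a, b]])).
  rewrite setIUl setICl setU0; apply/eqP; rewrite -measure_le0 -N'0.
  by apply: le_measure; rewrite ?inE//; apply: measurableI.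
- move=> x /= nle; have [xab|] := pselect ([set` `[a, b]] x); last by right.
  left; apply: NN'; apply: contrapT => Nx; apply: nle; rewrite lee_fin.
  by apply: hM => //; move: xab; rewrite /= in_itv.
Qed.

(** The essential supremum is attained, so that a bound on the norm holds outside
    of a single null set. This requires a < b, as the norm is 0 when a = b. *)
Lemma Linfty_norm_ae (a b M : R) (h : R -> R) : a < b ->
  (Linfty_norm a b h <= M%:E)%E ->
  exists2 N : set R, mu.-negligible N &
    forall x, a <= x <= b -> ~ N x -> `|h x| <= M.
Proof.
move=> ab; rewrite /Linfty_norm unlock /= ifT; last first.
  rewrite /mrestr setTI lebesgue_measure_itv /= lte_fin ab.
  by rewrite -EFinB lte_fin subr_gt0.
move=> /ess_supP[N [mN N0 sub]]; exists (N `&` [set` `[a, b]]).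
  exists (N `&` [set` `[a, b]]); split => //.
  by apply: measurableI => //; exact: measurable_itv.
move=> x xab Nx; rewrite -lee_fin; apply: contrapT => hx; apply: Nx; split.
  exact: sub.
by rewrite /= in_itv.
Qed.

(** One-sided increments suffice to bound the difference of two derivatives that are
    known to exist. *)
Lemma derive1_dist_le (a b M : R) (F G : R -> R) x : a < x < b ->
  derivable F x 1 -> derivable G x 1 ->
  (forall y, x <= y -> y <= b -> `|(F y - F x) - (G y - G x)| <= M * (y - x)) ->
  `|F^`()%classic x - G^`()%classic x| <= M.
Proof.
move=> /andP[_ xb] dF dG FG; apply/ler_addgt0Pr => e e0.
have e2 : 0 < e / 2 by rewrite divr_gt0.
have [d1 d10 F1] := derivable_linear_approx dF e2.
have [d2 d20 G1] := derivable_linear_approx dG e2.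
pose h := Num.min (Num.min d1 d2) (b - x) / 2.
have m0 : 0 < Num.min (Num.min d1 d2) (b - x) by rewrite !lt_min d10 d20 subr_gt0.
have h0 : 0 < h by rewrite divr_gt0.
have hm : h < Num.min (Num.min d1 d2) (b - x) by rewrite /h; lra.
move: hm; rewrite !lt_min => /andP[/andP[hd1 hd2] hb].
have := F1 (x + h); have := G1 (x + h); have := FG (x + h).
rewrite (addrAC x) subrr add0r (gtr0_norm h0).
move=> /(_ ltac:(lra) ltac:(lra)) le1 /(_ hd2) le2 /(_ hd1) le3.
rewrite -(ler_pM2r h0) -{1}(gtr0_norm h0) -normrM.
set A := F _ - F x in le1 le3; set B := G _ - G x in le1 le2.
have -> : (F^`()%classic x - G^`()%classic x) * h =
   (A - B) - (A - F^`()%classic x * h) + (B - G^`()%classic x * h) by ring.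
apply: le_trans (ler_normD _ _) _; apply: le_trans (lerD (ler_normB _ _) (lexx _)) _.
by lra.
Qed.

Lemma absolutely_continuous_on_point (a : R) (F : R -> R) :
  absolutely_continuous_on a a F.
Proof.
move=> e e0; exists 1 => // n u v uv _ _; rewrite big1// => i _.
have [au uvi va] := uv i.
by have -> : v i = u i; [lra|rewrite subrr normr0].
Qed.

(** Differentiability almost everywhere of F and G is essential here: elsewhere
    the values of the derivatives carry no information on the increments. *)
Lemma increment_dist_le_of_Linfty_norm (a b M : R) (F G : R -> R) : a < b ->
  0 <= M -> absolutely_continuous_on a b F -> absolutely_continuous_on a b G ->
  (Linfty_norm a b (fun x => F^`()%classic x - G^`()%classic x)%R <= M%:E)%E ->
  forall u v, a <= u -> u <= v -> v <= b ->
    `|(F v - F u) - (G v - G u)| <= M * (v - u).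
Proof.
move=> ab M0 acF acG /(Linfty_norm_ae ab)[N N0 NM] u v au uv vb.
have -> : (F v - F u) - (G v - G u) = (F v - G v) - (F u - G u) by ring.
have nF := absolutely_continuous_on_derivable_ae (ltW ab) acF.
have nG := absolutely_continuous_on_derivable_ae (ltW ab) acG.
have nab : mu.-negligible [set a; b].
  apply: negligibleU; apply/negligibleP; try exact: measurable_set1;
  exact: lebesgue_measure_set1.
have nN := negligibleU (negligibleU N0 nab) (negligibleU nF nG).
apply: (lipschitz_of_derivative_bound_ae (F := fun x => F x - G x) M0
  (absolutely_continuous_onB acF acG) nN) => // x xab.
move=> /not_orP[/not_orP[Nx /not_orP[xa xb]] /not_orP[dF dG]].
have xoo : a < x < b.
  by rewrite !lt_neqAle !(andbC (_ != _)); case/andP: xab => -> ->; rewrite /= eq_sym;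
   apply/andP; split; apply/eqP.
have {}dF : derivable F x 1 by apply: contrapT => ndF; exact: (dF (conj xoo ndF)).
have {}dG : derivable G x 1 by apply: contrapT => ndG; exact: (dG (conj xoo ndG)).
move=> e e0; have e2 : 0 < e / 2 by rewrite divr_gt0.
have [d1 d10 F1] := derivable_linear_approx dF e2.
have [d2 d20 G1] := derivable_linear_approx dG e2.
exists (Num.min d1 d2); first by rewrite lt_min d10.
move=> y _; rewrite lt_min => /andP[yd1 yd2].
have := F1 y yd1; have := G1 y yd2.
have -> : F y - G y - (F x - G x) = (F^`()%classic x - G^`()%classic x) * (y - x)
   + (F y - F x - F^`()%classic x * (y - x)) - (G y - G x - G^`()%classic x * (y - x)).
  by ring.
move=> le1 le2.
apply: le_trans (ler_normB _ _) _; apply: le_trans (lerD (ler_normD _ _) (lexx _)) _.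
rewrite normrM; have := ler_wpM2r (normr_ge0 (y - x)) (NM x xab Nx).
by lra.
Qed.

End Linfty.

Theorem theorem15 (R : realType) (a b : R) (F G : R -> R) :
  a <= b ->
  absolutely_continuous_on a b F ->
  absolutely_continuous_on a b G ->
  let f : R -> R := F^`()%classic in
  let g : R -> R := G^`()%classic in
  let Fhat := least_concave_majorant a b F in
  let Ghat := least_concave_majorant a b G in
  let fo := level_function a b F in
  let go := level_function a b G in
  [/\ absolutely_continuous_on a b Fhat,
      absolutely_continuous_on a b Ghat,
      Linfty_norm a b (fun x => fo x - go x)
        = Linfty_norm a b (fun x => Fhat^`()%classic x - Ghat^`()%classic x) &
      (Linfty_norm a b (fun x => Fhat^`()%classic x - Ghat^`()%classic x)%R
        <= Linfty_norm a b (fun x => f x - g x)%R)%E].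
Proof.
move=> le_ab acF acG f g Fhat Ghat fo go.
have norm_ge0 h : (0 <= Linfty_norm a b h)%E by exact: Lnorm_ge0.
have nab : lebesgue_measure.-negligible [set a; b].
  apply: negligibleU; apply/negligibleP; try exact: measurable_set1;
  exact: lebesgue_measure_set1.
move: (le_ab); rewrite le_eqVlt => /predU1P[eq_ab|ab].
  split => //; try by rewrite -eq_ab; exact: absolutely_continuous_on_point.
  apply: le_trans (norm_ge0 _); apply: (Linfty_norm_le (lexx 0) nab) => x.
  by rewrite -eq_ab -eq_le => /eqP <- []; left.
have acFhat := least_concave_majorant_absolutely_continuous ab acF.
have acGhat := least_concave_majorant_absolutely_continuous ab acG.
split => //.
have [->|fin] := eqVneq (Linfty_norm a b (fun x => f x - g x)) +oo%E.
  exact: leey.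
pose M := fine (Linfty_norm a b (fun x => f x - g x)).
have ME : Linfty_norm a b (fun x => f x - g x) = M%:E.
  by rewrite fineK// ge0_fin_numE// ltey.
have M0 : 0 <= M by rewrite fine_ge0.
have fgM : (Linfty_norm a b (fun x => f x - g x)%R <= M%:E)%E by rewrite ME.
have FGM := increment_dist_le_of_Linfty_norm ab M0 acF acG fgM.
rewrite ME.
have [B FB] := absolutely_continuous_on_bounded le_ab acF.
have [C GC] := absolutely_continuous_on_bounded le_ab acG.
have FBC x : a <= x <= b -> F x <= Num.max B C.
  by move=> /FB FxB; rewrite le_max FxB.
have GBC x : a <= x <= b -> G x <= Num.max B C.
  by move=> /GC GxC; rewrite le_max GxC orbT.
have hatM x y : a <= x -> x <= y -> y <= b ->
    `|(Fhat y - Fhat x) - (Ghat y - Ghat x)| <= M * (y - x).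
  move=> ax xy yb.
  have FG u v : a <= u -> u <= v -> v <= b -> F v - F u <= G v - G u + M * (v - u).
    by move=> au uv vb; have := FGM u v au uv vb; rewrite ler_norml => /andP[]; lra.
  have GF u v : a <= u -> u <= v -> v <= b -> G v - G u <= F v - F u + M * (v - u).
    by move=> au uv vb; have := FGM u v au uv vb; rewrite ler_norml => /andP[]; lra.
  have := least_concave_majorant_compare FBC GBC FG ax xy yb.
  have := least_concave_majorant_compare GBC FBC GF ax xy yb.
  by rewrite -/Fhat -/Ghat ler_norml => ? ?; apply/andP; split; lra.
have nF := absolutely_continuous_on_derivable_ae le_ab acFhat.
have nG := absolutely_continuous_on_derivable_ae le_ab acGhat.
apply: (Linfty_norm_le M0 (negligibleU nab (negligibleU nF nG))) => x xab.
move=> /not_orP[/not_orP[xa xb] /not_orP[dF dG]].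
have xoo : a < x < b.
  by rewrite !lt_neqAle !(andbC (_ != _)); case/andP: xab => -> ->; rewrite /= eq_sym;
   apply/andP; split; apply/eqP.
apply: (derive1_dist_le xoo).
- by apply: contrapT => ndF; exact: (dF (conj xoo ndF)).
- by apply: contrapT => ndG; exact: (dG (conj xoo ndG)).
- by move=> y xy yb; apply: hatM => //; case/andP: xab.
Qed.
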